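(* Let $\mathfrak{B}$ be a bornology on a metric space $X$ with a closed base. Let the ideal $\mathcal{I}$ on $\omega$ have a pseudounion. The following statements are equivalent. (1) $X$ satisfies $\mathrm{S}_1(\mathcal{I}\text{-}\Gamma_{\mathfrak{B}^s},\mathcal{O}_{\mathfrak{B}^s})$. (2) $X$ satisfies $\mathrm{S}_1(\Gamma_{\mathfrak{B}^s},\mathcal{O}_{\mathfrak{B}^s})$.
   Context: $(X,d)$ is an infinite metric space; $\omega$ is the set of natural numbers. A bornology $\mathfrak{B}$ on $X$ is a family of subsets of $X$ that is closed under subsets and finite unions and covers $X$. A base of $\mathfrak{B}$ is a subfamily $\mathfrak{B}_0\subseteq\mathfrak{B}$ such that every $B\in\mathfrak{B}$ is contained in some $B_0\in\mathfrak{B}_0$; it is a closed base if its members are closed. For $B\in\mathfrak{B}$, $\delta>0$: $B^\delta=\bigcup_{x\in B}\{y\in X:d(x,y)<\delta\}$. An ideal on $\omega$ is a family $\mathcal{I}\subseteq\mathcal{P}(\omega)$ closed under subsets and finite unions, containing all finite sets, with $\omega\notin\mathcal{I}$. A set $A\subseteq\omega$ is a pseudounion of $\mathcal{I}$ if $\omega\setminus A$ is infinite and $I\setminus A$ is finite for every $I\in\mathcal{I}$. Covers of $X$ never contain $X$ as an element. A cover $\mathcal{U}$ of $X$ by open sets is an open $\mathfrak{B}^s$-cover if for each $B\in\mathfrak{B}$ there are $U\in\mathcal{U}$ and $\delta>0$ with $B^\delta\subseteq U$; $\mathcal{O}_{\mathfrak{B}^s}$ is the class of these. An open cover $\{U_n:n\in\omega\}$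 (with its enumeration) is a $\gamma_{\mathfrak{B}^s}$-cover if it is infinite and for each $B\in\mathfrak{B}$ there are $n_0\in\omega$ and positive reals $\delta_n$ ($n\geq n_0$) with $B^{\delta_n}\subseteq U_n$ for all $n\geq n_0$; $\Gamma_{\mathfrak{B}^s}$ is the class of these. A countable open cover $\{U_n:n\in\omega\}$ (with its enumeration) is an $\mathcal{I}$-$\gamma_{\mathfrak{B}^s}$-cover if for each $B\in\mathfrak{B}$ there is a sequence $\{\delta_n\}$ of positive reals with $\{n\in\omega:B^{\delta_n}\nsubseteq U_n\}\in\mathcal{I}$; $\mathcal{I}\text{-}\Gamma_{\mathfrak{B}^s}$ is the class of these. $\mathrm{S}_1(\mathcal{A},\mathcal{B})$: for every sequence $\{A_n:n\in\omega\}$ of elements of $\mathcal{A}$ there are $a_n\in A_n$ ($n\in\omega$) such that $\{a_n:n\in\omega\}\in\mathcal{B}$ (for enumerated covers, with the enumeration $n\mapsto a_n$). *)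

(* Defs.v *)
From mathcomp Require Import all_boot all_order all_algebra.
From mathcomp Require Import all_classical all_reals.
From mathcomp Require Import topology.

Set Implicit Arguments.
Unset Strict Implicit.
Unset Printing Implicit Defensive.

Import Order.TTheory GRing.Theory Num.Theory.
Local Open Scope classical_set_scope.
Local Open Scope ring_scope.

Record bornology (X : Type) (BB : set (set X)) : Prop := Bornology {
  bornology_sub : forall A B : set X, BB B -> A `<=` B -> BB A ;
  bornology_setU : forall A B : set X, BB A -> BB B -> BB (A `|` B) ;
  bornology_cover : \bigcup_(B in BB) B = [set: X] }.

Record bornology_base (X : Type) (BB BB0 : set (set X)) : Prop :=
  BornologyBase {
    base_sub : BB0 `<=` BB ;
    base_cofinal : forall B, BB B -> exists2 B0, BB0 B0 & B `<=` B0 }.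

Definition has_closed_base (X : topologicalType) (BB : set (set X)) : Prop :=
  exists2 BB0 : set (set X), bornology_base BB BB0 &
    forall B0, BB0 B0 -> closed B0.

Record ideal_on_nat (I : set (set nat)) : Prop := IdealOnNat {
  ideal_sub : forall A B : set nat, I B -> A `<=` B -> I A ;
  ideal_setU : forall A B : set nat, I A -> I B -> I (A `|` B) ;
  ideal_finite : forall A : set nat, finite_set A -> I A ;
  ideal_proper : ~ I [set: nat] }.

Definition pseudounion (I : set (set nat)) (A : set nat) : Prop :=
  infinite_set (~` A) /\ forall J, I J -> finite_set (J `\` A).

Section Covers.
Variables (R : realType) (X : metricType R).
Implicit Types (BB : set (set X)) (B : set X).

Definition enlargement B (delta : R) : set X :=
  \bigcup_(x in B) [set y | mdist x y < delta].

(* Covers never contain the whole space as a member. *)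
Definition open_cover (UU : set (set X)) : Prop :=
  [/\ forall U, UU U -> open U, \bigcup_(U in UU) U = [set: X]
    & ~ UU [set: X]].

Definition open_Bs_cover BB : set (set (set X)) :=
  [set UU | open_cover UU /\
    forall B, BB B -> exists U, exists delta : R,
      [/\ UU U, 0 < delta & enlargement B delta `<=` U]].

(* An enumerated cover is a sequence U : nat -> set X, possibly with
   repetitions; the cover itself is range U. *)
Definition gamma_Bs_cover BB : set (nat -> set X) :=
  [set U | [/\ open_cover (range U), infinite_set (range U)
    & forall B, BB B -> exists (n0 : nat) (delta : nat -> R),
        forall n, (n0 <= n)%N ->
          0 < delta n /\ enlargement B (delta n) `<=` U n]].

Definition ideal_gamma_Bs_cover (I : set (set nat)) BB : set (nat -> set X) :=
  [set U | open_cover (range U) /\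
    forall B, BB B -> exists2 delta : nat -> R, (forall n, 0 < delta n) &
      I [set n | ~ (enlargement B (delta n) `<=` U n)]].

End Covers.

(* The selection principle S_1(A, B), for a class A of enumerated families
   and a class B of families. *)
Definition S1 (T : Type) (A : set (nat -> T)) (B : set (set T)) : Prop :=
  forall F : nat -> (nat -> T), (forall n, A (F n)) ->
    exists2 a : nat -> T, (forall n, range (F n) (a n)) & B (range a).

(* Main.v *)
Require Import Defs.
From mathcomp Require Import all_boot all_order all_algebra.
From mathcomp Require Import all_classical all_reals.
From mathcomp Require Import topology.

(** A gamma-cover is the same thing as an ideal-gamma-cover for the ideal of
    finite sets ([gamma_Bs_coverE]): the only difference in the definitions is
    that a gamma-cover must have infinitely many distinct members, and this is
    automatic.  Indeed a member [V] is a proper subset and so misses some point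
    [x]; as [x] belongs to all but finitely many terms of the sequence, [V]
    occurs only finitely often in it, for every [V].

    Since an ideal contains the finite sets, every gamma-cover is an
    I-gamma-cover, so selecting from I-gamma-covers is at least as hard as
    selecting from gamma-covers.  Conversely, let [A] be a pseudounion of [I]
    and let [k] be an injective sequence in the infinite complement of [A].
    The exceptional set in [I] of a bornological set meets the complement of
    [A] in a finite set, hence the subsequence along [k] of an I-gamma-cover
    is a gamma-cover ([gamma_Bs_cover_pseudounion]).  Members selected from
    these subsequences are members of the original covers, so the selection
    serves for both. *)

Local Open Scope classical_set_scope.

(** Every fibre of [f] is finite, so finitely many values would exhaust only
    finitely many indices. *)
Lemma infinite_range_finite_fibre (T : Type) (f : nat -> T) :
  (forall t, finite_set (f @^-1` [set t])) -> infinite_set (range f).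
Proof.
move=> fibre_fin range_fin; apply: infinite_nat.
suff -> : [set: nat] = \bigcup_(t in range f) (f @^-1` [set t]).
  exact: bigcup_finite.
by apply/seteqP; split=> n // _; exists (f n) => //; exists n.
Qed.

Lemma injective_seq_of_infinite (A : set nat) : infinite_set A ->
  exists2 k : nat -> nat, injective k & forall j, A (k j).
Proof.
move=> /infiniteP/ppcard_leP [k].
exists k; last by move=> j; exact: funS.
by move=> i j; apply: inj; rewrite in_setT.
Qed.

Lemma finite_nat_set_bounded (A : set nat) : finite_set A ->
  exists n0, forall n, (n0 <= n)%N -> ~ A n.
Proof.
move=> /finite_seqP [s ->]; exists (\max_(i <- s) i).+1 => n max_lt_n /= s_n.
move: max_lt_n; apply/negP; rewrite -leqNgt.
exact: (leq_bigmax_seq (F := id) n s_n isT).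
Qed.

Section Covers.
Context {R : realType} {X : metricType R}.
Variable BB : set (set X).

Lemma sub_enlargement (B : set X) (delta : R) : (0 < delta)%R ->
  B `<=` enlargement B delta.
Proof. by move=> delta_gt0 x Bx; exists x => //=; rewrite mdistxx. Qed.

Hypothesis BB_bornology : bornology BB.

(** The point [x] lies in some bornological set, hence in all of its
    enlargements, so that [U n] can miss [x] only at an exceptional [n]. *)
Lemma finite_missing (U : nat -> set X) (x : X) :
  (forall B, BB B -> exists2 delta : nat -> R, (forall n, (0 < delta n)%R) &
     finite_set [set n | ~ (enlargement B (delta n) `<=` U n)]) ->
  finite_set [set n | ~ U n x].
Proof.
move=> U_gamma; have : [set: X] x by [].
rewrite -(bornology_cover BB_bornology) => -[B BB_B Bx].
have [delta delta_gt0] := U_gamma B BB_B.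
apply: sub_finite_set => n /= nUx subU.
by apply: nUx; apply: subU; apply: sub_enlargement.
Qed.

Lemma gamma_Bs_coverE :
  gamma_Bs_cover BB = ideal_gamma_Bs_cover (@finite_set nat) BB.
Proof.
apply/seteqP; split=> U.
  move=> [U_cover _ U_gamma]; split=> // B /U_gamma [n0 [delta delta_ok]].
  (* the radii below [n0] are arbitrary; 1 makes them positive *)
  exists (fun n => if (n0 <= n)%N then delta n else 1%R) => [n|].
    by case: ifP => [/delta_ok[]|].
  apply: (sub_finite_set _ (finite_II n0)) => n /= badn.
  rewrite ltnNge; apply/negP => le_n0n.
  by apply: badn; rewrite le_n0n; case: (delta_ok n le_n0n).
move=> [U_cover U_gamma]; split=> //.
  apply: infinite_range_finite_fibre => V.
  have [->|/eqP VT] := eqVneq V [set: X].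
    suff -> : U @^-1` [set [set: X]] = set0 by exact: finite_set0.
    apply/seteqP; split=> // n /= UnT.
    by case: U_cover => _ _; apply; exists n.
  have [x nVx] : exists x, ~ V x.
    apply/existsNP => Vall; apply: VT.
    by apply/seteqP; split=> y // _; exact: Vall.
  apply: sub_finite_set (finite_missing U x U_gamma) => n /= ->.
  exact: nVx.
move=> B /U_gamma [delta delta_gt0 /finite_nat_set_bounded [n0 good]].
by exists n0, delta => n /good /= /contrapT.
Qed.

Lemma ideal_gamma_Bs_coverS (I J : set (set nat)) : I `<=` J ->
  ideal_gamma_Bs_cover I BB `<=` ideal_gamma_Bs_cover J BB.
Proof.
move=> subIJ U [U_cover U_gamma]; split=> // B /U_gamma [delta delta_gt0 badI].
by exists delta => //; exact: subIJ.
Qed.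

(** The exceptional set [J] of [B] lies in [I], so [J `\` A] is finite, and
    an injective [k] avoiding [A] enters [J] only through [J `\` A]. *)
Lemma gamma_Bs_cover_pseudounion (I : set (set nat)) (A : set nat)
    (k : nat -> nat) (U : nat -> set X) :
  (forall J, I J -> finite_set (J `\` A)) ->
  injective k -> (forall j, ~ A (k j)) ->
  ideal_gamma_Bs_cover I BB U -> gamma_Bs_cover BB (U \o k).
Proof.
move=> IA k_inj kA [[U_open _ U_proper] U_gamma].
have Uk_gamma B : BB B -> exists2 delta : nat -> R,
    (forall n, (0 < delta n)%R) &
    finite_set [set n | ~ (enlargement B (delta n) `<=` (U \o k) n)].
  move=> /U_gamma [delta delta_gt0 /IA J_fin].
  exists (delta \o k) => [n|]; first exact: delta_gt0.
  apply: sub_finite_set (finite_preimage (in2W k_inj) J_fin) => n /= badn.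
  by split=> //; exact: kA.
rewrite gamma_Bs_coverE; split=> //; split.
- by move=> _ [n _ <-]; apply: U_open; exists (k n).
- apply/seteqP; split=> x // _; apply: contrapT => x_missed.
  apply: infinite_nat; apply: sub_finite_set (finite_missing _ x Uk_gamma).
  by move=> n _ /= Ux; apply: x_missed; exists (U (k n)) => //; exists n.
- by move=> [n _ UnT]; apply: U_proper; exists (k n).
Qed.

End Covers.

(** A selection made from the subfamilies is already one from the families
    themselves, with the same range.  Both implications of the theorem are
    instances: the subfamily is the whole gamma-cover for one, and a
    subsequence of the I-gamma-cover for the other. *)
Lemma S1_refine (T : Type) (A A' : set (nat -> T)) (B : set (set T)) :
  (forall u, A u -> exists2 v, A' v & range v `<=` range u) ->
  S1 A' B -> S1 A B.
Proof.
move=> refine selA' F AF.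
have /choice [G AG] : forall n, exists v, A' v /\ range v `<=` range (F n).
  by move=> n; have [v] := refine _ (AF n); exists v.
have [a aG Ba] := selA' G (fun n => (AG n).1).
by exists a => // n; exact: (AG n).2.
Qed.

Theorem theorem3p16 (R : realType) (X : metricType R)
    (X_infinite : infinite_set [set: X])
    (BB : set (set X)) (BB_bornology : bornology BB)
    (BB_closed_base : has_closed_base BB)
    (I : set (set nat)) (I_ideal : ideal_on_nat I)
    (I_pseudounion : exists A : set nat, pseudounion I A) :
  S1 (ideal_gamma_Bs_cover I BB) (open_Bs_cover BB) <->
  S1 (gamma_Bs_cover BB) (open_Bs_cover BB).
Proof.
split; apply: S1_refine => U.
  rewrite gamma_Bs_coverE // => U_gamma; exists U => //.
  exact: ideal_gamma_Bs_coverS (ideal_finite I_ideal) _ U_gamma.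
have [A [A_coinf IA]] := I_pseudounion.
have [k k_inj kA] := injective_seq_of_infinite _ A_coinf.
move=> /(gamma_Bs_cover_pseudounion _ BB_bornology _ _ _ _ IA k_inj kA) Uk_gamma.
by exists (U \o k) => // _ [j _ <-]; exists (k j).
Qed.
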